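(* Suppose that the coordinates $X_1,\dotsc,X_n$ and $Y_1,\dotsc,Y_n$ of the random vectors $\mathbf{X}=(X_1,\dotsc,X_n)$ and $\mathbf{Y}=(Y_1,\dotsc,Y_n)$ are mutually independent and identically distributed with common mean $\mu$ and common variance $\sigma^2$. For $\mathbf{x},\mathbf{y}\in\mathbb{R}^n$ and $z>0$ let $$h(\mathbf{x},\mathbf{y},z)=(n-1)\log z-\frac12\sum_{i=1}^n\bigl(zx_i+(1-z)y_i\bigr)^2+\frac12\sum_{i=1}^n x_i^2,\qquad p(\mathbf{x},\mathbf{y},z)=\min\{1,\exp(h(\mathbf{x},\mathbf{y},z))\}.$$ Then, in the limit $n\to\infty$, $\frac1n h(\mathbf{X},\mathbf{Y},z)\to f_\sigma(z)$, where $$f_\sigma(z)=\log z-\sigma^2 z(z-1).$$ The acceptance probability $p(\mathbf{X},\mathbf{Y},z)$ converges to $1$ if $f_\sigma(z)>0$ and to $0$ if $f_\sigma(z)<0$.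
   Context: The function $p(\mathbf{x},\mathbf{y},z)$ is the acceptance probability of one ''stretch move'' of the affine invariant ensemble sampler: a walker at $\mathbf{x}\in\mathbb{R}^n$ is proposed to move to $z\mathbf{x}+(1-z)\mathbf{y}$, where $\mathbf{y}\in\mathbb{R}^n$ is the position of another walker and $z>0$ is the value of the stretching variable, and the proposal is accepted with probability $\min\bigl(1,z^{n-1}\pi'(z\mathbf{x}+(1-z)\mathbf{y})/\pi'(\mathbf{x})\bigr)$. Here the target is the $n$-dimensional standard normal density $\pi'(\mathbf{x})=c\exp\bigl(-\frac12\sum_{i=1}^n x_i^2\bigr)$, with $c$ the normalizing constant, which gives the stated formula $p=\min\{1,\exp(h)\}$. The vectors $\mathbf{X}$ and $\mathbf{Y}$ are the randomly chosen walkers for the move under consideration. The paper does not specify the mode of convergence; it obtains the first limit as an application of the Law of Large Numbers. *)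

(* Defs.v *)
From HB Require Import structures.
From mathcomp Require Import all_boot all_order all_algebra.
From mathcomp Require Import all_classical all_reals all_analysis.

Set Implicit Arguments.
Unset Strict Implicit.
Unset Printing Implicit Defensive.

Import Order.TTheory GRing.Theory Num.Theory.
Import numFieldNormedType.Exports.

Local Open Scope classical_set_scope.
Local Open Scope ring_scope.

Section iid.
Context (d : measure_display) (T : measurableType d) (R : realType)
  (P : probability T R) (I : choiceType).
Implicit Type W : I -> {RV P >-> R}.

Definition mutually_independent W : Prop :=
  forall (s : seq I) (B : I -> set R), uniq s ->
    (forall i, measurable (B i)) ->
    P (\bigcap_(i in [set` s]) (W i @^-1` B i)) =
      (\prod_(i <- s) P (W i @^-1` B i))%E.

(* The laws are compared on Borel sets only: a pushforward is a function on   *)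
(* all subsets of R, but only its values on measurable ones are meaningful.   *)
Definition identically_distributed W : Prop :=
  forall (i j : I) (B : set R), measurable B ->
    distribution P (W i) B = distribution P (W j) B.

End iid.

Section joint_family.
Context (d : measure_display) (T : measurableType d) (R : realType)
  (P : probability T R).

(* All the coordinates of two sequences as one family, so that independence   *)
(* and equality in law also hold across the two sequences.                    *)
Definition joint_family (X Y : nat -> {RV P >-> R}) (k : nat + nat) :
  {RV P >-> R} :=
  match k with inl i => X i | inr i => Y i end.

(* The random vector in R^n of the first n terms of a sequence.               *)
Definition random_vector (X : nat -> {RV P >-> R}) (n : nat) (w : T) :
  'rV[R]_n := \row_(i < n) X i w.

End joint_family.

Section stretch_move.
Context (R : realType).

Definition log_ratio (n : nat) (x y : 'rV[R]_n) (z : R) : R :=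
  (n%:R - 1) * ln z
  - 2^-1 * (\sum_(i < n) (z * x 0 i + (1 - z) * y 0 i) ^+ 2)
  + 2^-1 * (\sum_(i < n) x 0 i ^+ 2).

Definition acceptance_prob (n : nat) (x y : 'rV[R]_n) (z : R) : R :=
  Num.min 1 (expR (log_ratio x y z)).

Definition limit_rate (sigma z : R) : R := ln z - sigma ^+ 2 * (z * (z - 1)).

End stretch_move.

(* Main.v *)
Require Import Defs.
From HB Require Import structures.
From mathcomp Require Import all_boot all_order all_algebra.
From mathcomp Require Import all_classical all_reals all_analysis.
From mathcomp Require Import measurable_realfun lra ring.
Import Order.TTheory GRing.Theory Num.Theory.
Import numFieldNormedType.Exports.
Local Open Scope classical_set_scope.
Local Open Scope ring_scope.

Set Implicit Arguments.
Unset Strict Implicit.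
Unset Printing Implicit Defensive.

(* Up to the deterministic term [(1 - 1/n) ln z], the rate [h / n] is a
   difference of the averages of [X_i ^ 2] and of [(z X_i + (1 - z) Y_i) ^ 2],
   whose means are [s + mu ^ 2] and [(z ^ 2 + (1 - z) ^ 2) s + mu ^ 2] with
   [s = sigma ^ 2].  Both summands are nonnegative, pairwise independent,
   identically distributed and merely integrable, so the strong law needed is
   Etemadi's.  Its proof works along [k_n = floor (a ^ n)] with all of the first
   [k_n] terms truncated at the same level [a ^ n]: the geometric growth gives
   [sum_n k_n P (W > a ^ n) <= C E W], so that the truncation is almost surely
   not felt for large [n], and [sum_n E (W ^ 2; W <= a ^ n) / a ^ n <= C E W],
   so that the squared deviations of the truncated averages are almost surely
   summable.  Monotonicity of the partial sums interpolates between the [k_n] as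
   [a] decreases to 1.  The acceptance probability is then read off the sign of
   the limiting rate. *)

(** * Independence *)

(** Rectangles are stable under intersection, contain the whole space and generate the product
    sigma-algebra; the finite mass allows the constant exhaustion by [setT]. *)
Lemma measure_eq_rectangles (d1 d2 : measure_display) (T1 : measurableType d1)
    (T2 : measurableType d2) (R : realType)
    (m1 m2 : {measure set (T1 * T2) -> \bar R}) :
  (m1 setT < +oo)%E ->
  (forall A B, measurable A -> measurable B -> m1 (A `*` B) = m2 (A `*` B)) ->
  forall A, measurable A -> m1 A = m2 A.
Proof.
move=> m1oo m12; apply: (measure_unique
  [set A `*` B | A in measurable & B in measurable] (fun=> setT)).
- exact: measurable_prod_measurableType.
- move=> _ _ [A1 mA1 [A2 mA2 <-]] [B1 mB1 [B2 mB2 <-]].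
  exists (A1 `&` B1); first exact: measurableI.
  by exists (A2 `&` B2); [exact: measurableI|rewrite setXI].
- by move=> _; exists setT => //; exists setT => //; rewrite setXTT.
- by rewrite bigcup_const.
- by move=> _ [A mA [B mB <-]]; exact: m12.
- by [].
Qed.

Section independence.
Context (d : measure_display) (T : measurableType d) (R : realType)
  (P : probability T R).
Context (d' : measure_display) (S : measurableType d').

(** The target is a general measurable space because both real variables and pairs of coordinates
    occur. *)
Definition independent_pair (U V : T -> S) : Prop :=
  forall A B, measurable A -> measurable B ->
    P (U @^-1` A `&` V @^-1` B) = (P (U @^-1` A) * P (V @^-1` B))%E.

(** Independence identifies the joint law with the product of the two laws, and Tonelli then splits
    the integral. *)
Lemma independent_pair_expectation (U V : {RV P >-> S}) (f g : S -> R) :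
  measurable_fun setT f -> measurable_fun setT g ->
  (forall x, 0 <= f x) -> (forall x, 0 <= g x) ->
  independent_pair U V ->
  (\int[P]_w (f (U w) * g (V w))%:E =
   \int[P]_w (f (U w))%:E * \int[P]_w (g (V w))%:E)%E.
Proof.
move=> mf mg f0 g0 UV.
have mUV : measurable_fun setT (fun w => (U w, V w)).
  by apply: measurable_fun_pair.
pose UVf : {mfun T >-> (S * S)%type} := mfun_Sub (mem_set mUV).
pose h := fun p : S * S => (f p.1 * g p.2)%:E.
have mh : @measurable_fun _ _ (S * S)%type (\bar R) setT h.
  apply/measurable_EFinP/measurable_funM.
    by apply: (measurableT_comp mf); exact: measurable_fst.
  by apply: (measurableT_comp mg); exact: measurable_snd.
have h0 p : (0 <= h p)%E by rewrite lee_fin mulr_ge0.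
have <- : (\int[distribution P UVf]_p h p = \int[P]_w (f (U w) * g (V w))%:E)%E.
  by rewrite ge0_integral_distribution.
rewrite (@eq_measure_integral _ _ _ _ (distribution P U \x distribution P V)%E);
  last by move=> A mA _; apply/esym; apply: product_measure_unique.
have mfE : measurable_fun setT (EFin \o f) by exact/measurable_EFinP.
have mgE : measurable_fun setT (EFin \o g) by exact/measurable_EFinP.
have f0E y : (0 <= (EFin \o f) y)%E by rewrite lee_fin.
have g0E y : (0 <= (EFin \o g) y)%E by rewrite lee_fin.
have := ge0_integral_distribution (P := P) U mfE f0E.
have := ge0_integral_distribution (P := P) V mgE g0E.
rewrite /comp => <- <-; rewrite fubini_tonelli1//.
rewrite (eq_integral (fun x => (f x)%:E * \int[distribution P V]_y (g y)%:E)%E)//.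
  rewrite ge0_integralZr// => [x _|]; first exact: f0E.
  by apply: integral_ge0 => y _; exact: g0E.
move=> x _; rewrite /fubini_F.
by rewrite -(ge0_integralZl _ measurableT mgE (fun y _ => g0E y) (f0E x)).
Qed.

End independence.

Section independence_of_pairs.
Context (d : measure_display) (T : measurableType d) (R : realType)
  (P : probability T R).
Context (d1 d2 : measure_display) (S1 : measurableType d1)
  (S2 : measurableType d2).

Lemma measurable_pair_preimage (U1 : {RV P >-> S1}) (U2 : {RV P >-> S2}) A :
  measurable A -> measurable ((fun w => (U1 w, U2 w)) @^-1` A).
Proof.
move=> mA; rewrite -[X in measurable X]setTI.
by apply: (measurable_fun_pair (f := U1) (g := U2)).
Qed.

(** For fixed [E] both sides are finite measures in [A], so agreement on rectangles suffices. *)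
Lemma independent_rectangles (U1 : {RV P >-> S1}) (U2 : {RV P >-> S2})
    (E : set T) : measurable E ->
  (forall A1 A2, measurable A1 -> measurable A2 ->
    P (U1 @^-1` A1 `&` U2 @^-1` A2 `&` E) =
    (P (U1 @^-1` A1 `&` U2 @^-1` A2) * P E)%E) ->
  forall A, measurable A ->
  P ((fun w => (U1 w, U2 w)) @^-1` A `&` E) =
  (P ((fun w => (U1 w, U2 w)) @^-1` A) * P E)%E.
Proof.
move=> mE UE A mA.
have mU : measurable_fun setT (fun w => (U1 w, U2 w)).
  by apply: measurable_fun_pair.
pose U : {mfun T >-> (S1 * S2)%type} := mfun_Sub (mem_set mU).
have r0 : 0 <= fine (P E) by rewrite fine_ge0.
have PE : (fine (P E))%:E = P E by rewrite fineK// fin_num_measure.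
pose m1 := pushforward (mrestr P mE) U.
pose m2 := mscale (NngNum r0) (distribution P U).
have := @measure_eq_rectangles _ _ _ _ R m1 m2.
rewrite /m1 /m2 /= => /(_ mU) H; rewrite [RHS]muleC -PE; apply: H => //.
  rewrite /pushforward /mrestr preimage_setT setTI.
  by apply: le_lt_trans (probability_le1 P mE) (ltry 1).
move=> A1 A2 mA1 mA2; rewrite /mscale /distribution /pushforward /mrestr /=.
by rewrite PE [RHS]muleC; exact: UE.
Qed.

Lemma identically_distributed_pair (U1 V1 : {RV P >-> S1})
    (U2 V2 : {RV P >-> S2}) :
  (forall A1 A2, measurable A1 -> measurable A2 ->
    P (U1 @^-1` A1 `&` U2 @^-1` A2) = P (V1 @^-1` A1 `&` V2 @^-1` A2)) ->
  forall A, measurable A ->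
  P ((fun w => (U1 w, U2 w)) @^-1` A) = P ((fun w => (V1 w, V2 w)) @^-1` A).
Proof.
move=> UV A mA.
have mU : measurable_fun setT (fun w => (U1 w, U2 w)).
  by apply: measurable_fun_pair.
have mV : measurable_fun setT (fun w => (V1 w, V2 w)).
  by apply: measurable_fun_pair.
pose U : {mfun T >-> (S1 * S2)%type} := mfun_Sub (mem_set mU).
pose V : {mfun T >-> (S1 * S2)%type} := mfun_Sub (mem_set mV).
have H := @measure_eq_rectangles _ _ _ _ R (distribution P U) (distribution P V).
apply: (H _ _ A mA); last exact: UV.
by apply: le_lt_trans (ltry 1); exact: probability_le1.
Qed.

End independence_of_pairs.

(** * Geometric sums and subsequences *)

Section geometric_truncation.
Context (R : realFieldType).

(* The scale [c] is what the induction on [N] moves; it is used at [c = 1]. *)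
Lemma geometric_tail_le (a w c : R) (N : nat) : 1 < a -> 0 < w -> 0 < c ->
  \sum_(n < N) (w <= c * a ^+ n)%R%:R / (c * a ^+ n) <=
    Num.min c^-1 w^-1 * (a / (a - 1)).
Proof.
move=> a1 w0; elim: N c => [|N IH] c c0.
  by rewrite big_ord0 mulr_ge0// ?le_min ?invr_ge0 ?ltW// divr_gt0//; lra.
have a0 : 0 < a by lra.
have aB : 0 < a - 1 by lra.
rewrite big_ord_recl expr0 mulr1.
have -> : \sum_(i < N) (w <= c * a ^+ lift ord0 i)%R%:R / (c * a ^+ lift ord0 i) =
  \sum_(i < N) (w <= (c * a) * a ^+ i)%R%:R / ((c * a) * a ^+ i).
  by apply: eq_bigr => i _; rewrite lift0 exprS mulrA.
have {}IH := IH (c * a) (mulr_gt0 c0 a0).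
have ca : (c * a)^-1 <= c^-1.
  by rewrite lef_pV2 ?posrE ?mulr_gt0// ler_peMr; lra.
have aa0 : 0 <= a / (a - 1) by rewrite divr_ge0; lra.
(* If [w <= c], the first term counts and [1/c + (1/(c a)) (a/(a - 1)) = (1/c) (a/(a - 1))];
   otherwise it vanishes and the bound at [c * a] is at most the one at [c]. *)
have [wc|cw] := leP w c.
  rewrite mul1r min_l; last by rewrite lef_pV2.
  apply: le_trans (lerD (lexx _) IH) _.
  apply: (@le_trans _ _ (c^-1 + (c * a)^-1 * (a / (a - 1)))).
    by rewrite lerD2l ler_wpM2r// ge_min lexx.
  by rewrite le_eqVlt; apply/orP; left; apply/eqP; field; rewrite !gt_eqF.
rewrite mul0r add0r; apply: le_trans IH _; rewrite ler_wpM2r//.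
by rewrite le_min !ge_min ca lexx orbT.
Qed.

(** A geometric sum is comparable to its largest term, here below [w]. *)
Lemma geometric_head_le (a w : R) (N : nat) : 1 < a -> 0 <= w ->
  \sum_(n < N) (a ^+ n < w)%R%:R * a ^+ n <= w * (a / (a - 1)).
Proof.
move=> a1 w0.
have a0 : 0 < a by lra.
have aB : 0 < a - 1 by lra.
(* Strengthened for the induction: [a ^+ N] governs while all terms count, [a * w] once [a ^+ N] has
   reached [w]. *)
suff: \sum_(n < N) (a ^+ n < w)%R%:R * a ^+ n <= Num.min (a ^+ N) (a * w) / (a - 1).
  move/le_trans; apply; rewrite mulrCA mulrA ler_wpM2r ?invr_ge0 ?(ltW aB)//.
  by rewrite ge_min lexx orbT.
elim: N => [|N IH].
  by rewrite big_ord0 divr_ge0 ?(ltW aB)// le_min exprn_ge0 ?mulr_ge0// ltW.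
rewrite big_ord_recr /=.
have aN : 0 < a ^+ N by rewrite exprn_gt0.
have [aw|wa] := ltP (a ^+ N) w.
  rewrite mul1r [X in _ <= X / _]min_l; last by rewrite exprS ler_wpM2l// ltW.
  apply: le_trans (lerD IH (lexx _)) _.
  apply: (@le_trans _ _ (a ^+ N / (a - 1) + a ^+ N)).
    by rewrite lerD2r ler_wpM2r ?invr_ge0 ?(ltW aB)// ge_min lexx.
  by rewrite le_eqVlt; apply/orP; left; apply/eqP; rewrite exprS; field; rewrite gt_eqF.
rewrite mul0r addr0; apply: le_trans IH _.
rewrite ler_wpM2r ?invr_ge0 ?(ltW aB)// le_min !ge_min lexx orbT andbT exprS.
by rewrite ler_peMl// ltW.
Qed.

End geometric_truncation.

Section interpolation.
Context (R : realType).

Lemma cvgy_exprn (a : R) : 1 < a -> a ^+ n @[n --> \oo] --> +oo.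
Proof.
move=> a1; apply/cvgryPge => A.
have aB : 0 < a - 1 by lra.
(* Bernoulli's inequality gives at least linear growth. *)
have bern n : 1 + n%:R * (a - 1) <= a ^+ n.
  elim: n => [|n IH]; first by rewrite mul0r addr0 expr0.
  rewrite exprS; apply: (@le_trans _ _ (a * (1 + n%:R * (a - 1)))).
    have n0 : 0 <= n%:R :> R by rewrite ler0n.
    rewrite -natr1 -subr_ge0.
    apply: le_trans (mulr_ge0 n0 (sqr_ge0 (a - 1))) _.
    by rewrite le_eqVlt; apply/orP; left; apply/eqP; ring.
  by rewrite ler_wpM2l//; lra.
have [N HN] : exists N, A <= N%:R * (a - 1).
  exists (Num.truncn (A / (a - 1))).+1.
  rewrite -ler_pdivrMr//.
  by rewrite ltW// truncnS_gt.
near=> n; apply: le_trans (bern n).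
apply: le_trans HN _; apply: (@le_trans _ _ (n%:R * (a - 1))); last by lra.
rewrite ler_wpM2r ?(ltW aB)//.
by rewrite ler_nat; near: n; exact: nbhs_infty_ge.
Unshelve. all: by end_near. Qed.

(** As [a ^+ n >= 1], its integer part [k] is at least 1, whence [a ^+ n < k + 1 <= 2 k]. *)
Lemma truncn_exprn_bounds (a : R) n : 1 <= a ->
  [/\ 0 < (Num.truncn (a ^+ n))%:R :> R, (Num.truncn (a ^+ n))%:R <= a ^+ n,
   a ^+ n <= 2 * (Num.truncn (a ^+ n))%:R & a ^+ n - 1 <= (Num.truncn (a ^+ n))%:R].
Proof.
move=> a1.
have a1n : 1 <= a ^+ n by rewrite exprn_ege1.
have k1 : (0 < Num.truncn (a ^+ n))%N by rewrite truncn_gt0.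
have k1R : 1 <= (Num.truncn (a ^+ n))%:R :> R by rewrite ler1n.
have := truncnS_gt (a ^+ n); rewrite -natr1 => kS.
have kle : (Num.truncn (a ^+ n))%:R <= a ^+ n by rewrite truncn_le; lra.
split; lra.
Qed.

Lemma exprn_itv (a x : R) : 1 < a -> 1 <= x ->
  exists n, a ^+ n <= x /\ x < a ^+ n.+1.
Proof.
move=> a1 x1.
have [N _ HN] : \forall n \near \oo, x + 1 <= a ^+ n.
  by move/cvgryPge : (cvgy_exprn a1); apply.
have ex : exists n, x < a ^+ n.
  by exists N; apply: lt_le_trans (HN N _) => /=; [lra|].
case: (ex_minnP ex) => -[|n] xn minn.
  by move: xn; rewrite expr0; lra.
exists n; split => //; rewrite leNgt; apply/negP => /minn.
by rewrite ltnn.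
Qed.

(* The ratio of successive indices [truncn (a ^+ n)] tends to [a], which can be
   taken arbitrarily close to [1]. *)
Lemma cvg_average_geometric_subseq (S : nat -> R) (m : R) :
  0 <= m -> (forall n, 0 <= S n) ->
  {homo S : i j / (i <= j)%N >-> i <= j} ->
  (forall j : nat, let a : R := 1 + j.+1%:R^-1 in
    (Num.truncn (a ^+ n))%:R^-1 * S (Num.truncn (a ^+ n)) @[n --> \oo] --> m) ->
  n%:R^-1 * S n @[n --> \oo] --> m.
Proof.
move=> m0 S0 Smono Scvg; apply/cvgrPdist_le => /= e e0.
(* With [b = 1 / (j + 1)], both errors found below for [S N / N] are at most [b (m + 2)]:
   [b m + b + b ^ 2] from above, and [b m + b] plus a rounding loss [m / N <= b] from below. *)
have [j je] : exists j : nat, j.+1%:R^-1 * (2 * m + 2) <= e.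
  exists (Num.truncn ((2 * m + 2) / e)).
  rewrite mulrC ler_pdivrMr ?ltr0n// [leRHS]mulrC -ler_pdivrMr//.
  by rewrite ltW// truncnS_gt.
set b : R := j.+1%:R^-1 in je.
have b0 : 0 < b by rewrite invr_gt0 ltr0n.
have b1 : b <= 1 by rewrite invf_le1 ?ltr0n// ler1n.
have := Scvg j; rewrite -/b /=; set a := 1 + b => /cvgrPdist_le /(_ b b0) [K _ HK].
have a1 : 1 < a by rewrite /a; lra.
(* [M0] makes the exponent [n] that brackets [N] at least [K]; [M1] keeps the rounding loss [m / N]
   within [b]. *)
have [M0 HM0] : exists M0 : nat, a ^+ K <= M0%:R.
  by exists (Num.truncn (a ^+ K)).+1; rewrite ltW// truncnS_gt.
have [M1 HM1] : exists M1 : nat, m <= M1%:R * b.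
  exists (Num.truncn (m / b)).+1; rewrite -ler_pdivrMr//.
  by rewrite ltW// truncnS_gt.
near=> N.
have N0 : (0 < N)%N by near: N; exact: nbhs_infty_gt.
have N0R : 0 < N%:R :> R by rewrite ltr0n.
have N1R : 1 <= N%:R :> R by rewrite ler1n.
have NM0 : a ^+ K <= N%:R.
  by apply: le_trans HM0 _; rewrite ler_nat; near: N; exact: nbhs_infty_ge.
have NM1 : m <= N%:R * b.
  apply: le_trans HM1 _; rewrite ler_pM2r// ler_nat.
  by near: N; exact: nbhs_infty_ge.
have [n [an aSn]] := exprn_itv a1 N1R.
have Kn : (K <= n)%N.
  rewrite leqNgt; apply/negP => nK.
  have : a ^+ n.+1 <= a ^+ K by rewrite ler_weXn2l// ltW.
  by move=> /le_trans /(_ NM0); lra.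
have [k0 kle _ kge] := truncn_exprn_bounds n (ltW a1).
have [k0' kle' _ kge'] := truncn_exprn_bounds n.+1 (ltW a1).
have := HK n Kn; have := HK n.+1 (leqW Kn) => /=.
set k := Num.truncn (a ^+ n) in k0 kle kge *.
set k' := Num.truncn (a ^+ n.+1) in k0' kle' kge' *.
(* Since [k <= a ^+ n <= N < a ^+ n.+1], also [k <= N <= k'], and monotonicity squeezes [S N]
   between values at geometric indices. *)
have lekN : (k <= N)%N by rewrite -(ler_nat R); lra.
have leNk' : (N <= k')%N.
  rewrite leqNgt; apply/negP => k'N.
  have : k'.+1%:R <= N%:R :> R by rewrite ler_nat.
  by have := truncnS_gt (a ^+ n.+1); rewrite -/k'; lra.
have SkN := Smono _ _ lekN; have SNk' := Smono _ _ leNk'.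
rewrite !ler_distl => /andP[up _] /andP[_ lo].
have up' : S k' <= (m + b) * k'%:R by rewrite -ler_pdivrMr// mulrC; lra.
have lo' : (m - b) * k%:R <= S k by rewrite -ler_pdivlMr// mulrC; lra.
have S0N := S0 N.
rewrite exprS in aSn kle'.
set A := a ^+ n in an aSn kle kge kle'.
(* From [N < (1 + b) A] and [A <= N]. *)
have AN : (1 - b) * N%:R <= A.
  have : b * A <= b * N%:R by rewrite ler_wpM2l// ltW.
  by move: aSn; rewrite /a; lra.
have upN : S N <= (m + e) * N%:R.
  apply: le_trans SNk' _; apply: le_trans up' _.
  apply: (@le_trans _ _ ((m + b) * (a * N%:R))).
    rewrite ler_wpM2l//; first lra.
    by apply: le_trans kle' _; rewrite ler_wpM2l//; lra.
  rewrite mulrA ler_wpM2r// ?(ltW N0R)//.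
  have : b * b <= b by rewrite ler_piMr// ltW.
  have := mulr_ge0 (ltW b0) m0.
  by move: je; rewrite /a; lra.
have loN : (m - e) * N%:R <= S N.
  have bm0 := mulr_ge0 (ltW b0) m0.
  (* If [m < b], the factor [m - b] is negative; but then [m - e] is negative too, and [S N >= 0]
     suffices. *)
  have [mb|bm] := ltP m b.
    apply: le_trans S0N; rewrite nmulr_rle0 ?(ltW N0R)//.
    by move: je; lra.
  apply: le_trans SkN; apply: le_trans lo'.
  have mb0 : 0 <= m - b by lra.
  apply: (@le_trans _ _ ((m - b) * ((1 - b) * N%:R - 1))).
    have bb : 0 <= b * b * N%:R by rewrite !mulr_ge0 ?ltW.
    have : b * (2 * m + 2) * N%:R <= e * N%:R by rewrite ler_wpM2r// ltW.
    have := mulr_ge0 bm0 (ltW N0R).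
    by move: NM1; lra.
  by rewrite ler_wpM2l//; lra.
apply/andP; split.
  by rewrite lerBlDr mulrC ler_pdivrMr.
by rewrite -lerBlDr mulrC ler_pdivlMr.
Unshelve. all: by end_near. Qed.

End interpolation.

(** * The strong law of large numbers *)

Lemma Lfun2_sqr (d : measure_display) (T : measurableType d) (R : realType)
    (P : probability T R) (f : T -> R) :
  measurable_fun setT f -> (\int[P]_w (f w ^+ 2)%:E < +oo)%E ->
  f \in Lfun P 2%:E.
Proof.
move=> mf foo; apply/andP; split; first by rewrite inE.
rewrite inE /= /finite_norm unlock /Lnorm.
rewrite poweR_lty//; apply: le_lt_trans foo.
rewrite le_eqVlt; apply/orP; left; apply/eqP; apply: eq_integral => w _ /=.
by rewrite -[2]/(2%:R) powR_mulrn// real_normK// num_real.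
Qed.

Lemma Lfun2_bounded (d : measure_display) (T : measurableType d) (R : realType)
    (P : probability T R) (f : T -> R) (c : R) :
  measurable_fun setT f -> (forall w, `|f w| <= c) -> f \in Lfun P 2%:E.
Proof.
move=> mf fc; apply: Lfun2_sqr => //.
apply: (@le_lt_trans _ _ (\int[P]_w (c ^+ 2)%:E)%E).
  apply: ge0_le_integral => //.
  - by move=> w _; rewrite lee_fin sqr_ge0.
  - by apply/measurable_EFinP; exact: measurable_funX.
  - by move=> w _; rewrite lee_fin -real_normK ?num_real// lerXn2r//
      nnegrE// (le_trans _ (fc w)).
by rewrite integral_cst//= probability_setT mule1 ltry.
Qed.

(** By bilinearity each partial sum is uncorrelated with the next term, so the cross term vanishes
    at each induction step. *)
Lemma variance_sum_uncorrelated (d : measure_display) (T : measurableType d)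
    (R : realType) (P : probability T R) (f : nat -> T -> R) (n : nat) :
  (forall i, f i \in Lfun P 2%:E) ->
  (forall i j, i != j -> covariance P (f i) (f j) = 0%E) ->
  ('V_P[(fun w => \sum_(i < n) f i w)%R] = \sum_(i < n) 'V_P[f i])%E.
Proof.
move=> f2 cov0.
have sum2 k : (fun w => \sum_(i < k) f i w) \in Lfun P 2%:E.
  elim: k => [|k IH].
    by under eq_fun do rewrite big_ord0; rewrite Lfun_cst.
  under eq_fun do rewrite big_ord_recr/=.
  by rewrite (rpredD IH (f2 k)) // lee1n.
have covS k j : (k <= j)%N -> covariance P (fun w => \sum_(i < k) f i w) (f j) = 0%E.
  elim: k => [_|k IH kj].
    by under eq_fun do rewrite big_ord0; rewrite covariance_cst_l.
  under eq_fun do rewrite big_ord_recr/=.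
  have := covarianceDl (sum2 k) (f2 k) (f2 j).
  rewrite /(_ \+ _) => ->; rewrite IH 1?ltnW// cov0 ?adde0//.
  by rewrite ltn_eqF.
elim: n => [|n IH].
  by under eq_fun do rewrite big_ord0; rewrite big_ord0 variance_cst.
under eq_fun do rewrite big_ord_recr/=.
have := varianceD (sum2 n) (f2 n).
by rewrite /(_ \+ _) => ->; rewrite covS// mule0 adde0 IH big_ord_recr.
Qed.

(** This plays the part of Borel-Cantelli: exchanging sum and integral makes the pointwise series
    integrable, hence almost surely finite, so its terms tend to 0. *)
Lemma ae_cvg0_summable (d : measure_display) (T : measurableType d)
    (R : realType) (P : {measure set T -> \bar R}) (f : nat -> T -> R) :
  (forall n, measurable_fun setT (f n)) -> (forall n w, 0 <= f n w) ->
  (\sum_(0 <= n <oo) \int[P]_w (f n w)%:E < +oo)%E ->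
  {ae P, forall w, f n w @[n --> \oo] --> (0 : R)}.
Proof.
move=> mf f0 foo.
have mfE n : measurable_fun setT (EFin \o f n) by exact/measurable_EFinP.
have fE0 n w : [set: T] w -> (0 <= (EFin \o f n) w)%E by rewrite lee_fin.
have := integral_nneseries P measurableT mfE fE0.
rewrite /comp => intE; rewrite -intE in foo.
have intf : P.-integrable setT (fun w => \sum_(0 <= n <oo) (f n w)%:E)%E.
  apply/integrableP; split.
    by apply: (ge0_emeasurable_sum (P := xpredT)) => [k w _ _|k _];
      [exact: fE0|exact: mfE].
  rewrite (eq_integral (fun w => \sum_(0 <= n <oo) (f n w)%:E)%E)// => w _.
  by rewrite gee0_abs//; apply: nneseries_ge0 => k _ _; exact: fE0.
have := integrable_ae measurableT intf.
apply: filterS => w /(_ Logic.I) fin.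
have woo : (\sum_(0 <= n <oo) (f n w)%:E < +oo)%E by rewrite ltey_eq fin.
have /cvg_series_cvg_0 := nnseries_is_cvg (f0 ^~ w) woo.
exact.
Qed.

Lemma integral_identically_distributed (d d' : measure_display)
    (T : measurableType d) (S : measurableType d') (R : realType)
    (P : probability T R) (U V : {RV P >-> S}) (f : S -> \bar R) :
  (forall A, measurable A -> P (U @^-1` A) = P (V @^-1` A)) ->
  measurable_fun setT f -> (forall x, (0 <= f x)%E) ->
  (\int[P]_w f (U w) = \int[P]_w f (V w))%E.
Proof.
move=> UV mf f0.
have := ge0_integral_distribution (P := P) U mf f0.
have := ge0_integral_distribution (P := P) V mf f0.
rewrite /comp => <- <-; apply: eq_measure_integral => A mA _; exact: UV.
Qed.

Section covariance_independent.
Context (d : measure_display) (T : measurableType d) (R : realType)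
  (P : probability T R).

(** The expectation of the product factors, and square integrability keeps both terms of the
    covariance finite, so that they cancel. *)
Lemma covariance_independent_ge0 (d' : measure_display) (S : measurableType d')
    (U V : {RV P >-> S}) (f g : S -> R) :
  measurable_fun setT f -> measurable_fun setT g ->
  (forall x, 0 <= f x) -> (forall x, 0 <= g x) ->
  (fun w => f (U w)) \in Lfun P 2%:E -> (fun w => g (V w)) \in Lfun P 2%:E ->
  independent_pair P U V ->
  covariance P (fun w => f (U w)) (fun w => g (V w)) = 0%E.
Proof.
move=> mf mg f0 g0 f2 g2 UV.
have Pfin : P setT \is a fin_num by rewrite fin_num_measure.
have f1 := Lfun_subset12 Pfin f2; have g1 := Lfun_subset12 Pfin g2.
rewrite covarianceE//; last exact: Lfun2_mul_Lfun1.
suff -> : ('E_P[(fun w => f (U w)) * (fun w => g (V w))] =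
    'E_P[fun w => f (U w)] * 'E_P[fun w => g (V w)])%E.
  by rewrite subee// fin_numM// expectation_fin_num.
by rewrite unlock; exact: independent_pair_expectation.
Qed.

End covariance_independent.

Lemma sume_const_ge0 (R : realDomainType) (x : \bar R) (n : nat) :
  (0 <= x)%E -> (\sum_(i < n) x = n%:R%:E * x)%E.
Proof.
move=> x0; elim: n => [|n IH]; first by rewrite big_ord0 mul0e.
by rewrite big_ord_recr/= IH -natr1 EFinD ge0_muleDl ?lee_fin// mul1e.
Qed.

(** Tonelli for series: it turns the pointwise geometric bounds into summable expectations. *)
Lemma nneseries_integral_lty (d : measure_display) (T : measurableType d)
    (R : realType) (P : {measure set T -> \bar R}) (f : nat -> T -> R)
    (g : T -> R) :
  (forall n, measurable_fun setT (f n)) -> (forall n w, 0 <= f n w) ->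
  measurable_fun setT g -> (forall N w, \sum_(n < N) f n w <= g w) ->
  (\int[P]_w (g w)%:E < +oo)%E ->
  (\sum_(0 <= n <oo) \int[P]_w (f n w)%:E < +oo)%E.
Proof.
move=> mf f0 mg fg goo.
have mfE n : measurable_fun setT (EFin \o f n) by exact/measurable_EFinP.
have fE0 n w : [set: T] w -> (0 <= (EFin \o f n) w)%E by rewrite lee_fin.
have := integral_nneseries P measurableT mfE fE0.
rewrite /comp => <-; apply: le_lt_trans goo; apply: ge0_le_integral => //.
- by move=> w _; apply: nneseries_ge0 => k _ _; exact: fE0.
- by apply: (ge0_emeasurable_sum (P := xpredT)) => [k w _ _|k _];
    [exact: fE0|exact: mfE].
- exact/measurable_EFinP.
- move=> w _; apply: lime_le.
    by apply: is_cvg_nneseries => k _ _; exact: fE0.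
  by apply: nearW => N; rewrite big_mkord sumEFin lee_fin.
Qed.

Section truncation.
Context (R : realType).

(* The maximum makes [truncate c] nonnegative on all of [R]; it is only used at
   nonnegative arguments. *)
Definition truncate (c x : R) : R := Num.max 0 x * (x <= c)%R%:R.

Lemma measurable_le_cst (c : R) :
  measurable_fun setT (fun x : R => (x <= c)%R%:R : R).
Proof.
rewrite (_ : (fun x : R => (x <= c)%R%:R : R) = \1_(`]-oo, c]%classic)).
  exact: measurable_indic.
by apply/funext => x; rewrite indicE mem_setE in_itv.
Qed.

Lemma measurable_truncate (c : R) : measurable_fun setT (truncate c).
Proof.
apply: measurable_funM; last exact: measurable_le_cst.
exact: measurable_maxr.
Qed.

Lemma truncate_ge0 (c x : R) : 0 <= truncate c x.
Proof. by rewrite mulr_ge0// le_max lexx. Qed.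

Lemma truncate_le_cst (c x : R) : 0 <= c -> truncate c x <= c.
Proof.
move=> c0; rewrite /truncate; case: (leP x c) => xc; rewrite ?mulr1 ?mulr0//.
by rewrite ge_max c0.
Qed.

Lemma truncateE (c x : R) : 0 <= x -> truncate c x = x * (x <= c)%R%:R.
Proof. by move=> x0; rewrite /truncate max_r. Qed.

End truncation.

(** * Etemadi's argument for nonnegative, pairwise independent variables *)

Section strong_law.
Context (d : measure_display) (T : measurableType d) (R : realType)
  (P : probability T R).
Variables (W : nat -> {RV P >-> R}) (m : R).
Hypothesis W0 : forall i w, 0 <= W i w.
Hypothesis Windep : forall i j, i != j -> independent_pair P (W i) (W j).
Hypothesis Wid : forall i B, measurable B -> P (W i @^-1` B) = P (W 0 @^-1` B).
Hypothesis WE : ('E_P[W 0] = m%:E)%E.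

Let intW : (\int[P]_w (W 0 w)%:E = m%:E)%E.
Proof. by rewrite -WE expectation_def. Qed.

Let m_ge0 : 0 <= m.
Proof. by rewrite -lee_fin -intW integral_ge0// => w _; rewrite lee_fin. Qed.

(** One level [c] for all indices keeps the truncated variables identically distributed, with the
    common mean [e_ c]. *)
Let T_ (c : R) i w := truncate c (W i w).
Let e_ (c : R) := fine ('E_P[T_ c 0])%E.

Let mT c i : measurable_fun setT (T_ c i).
Proof. by apply: measurableT_comp => //; exact: measurable_truncate. Qed.

Let m_le c i : measurable_fun setT (fun w => (W i w <= c)%R%:R : R).
Proof. exact: (measurableT_comp (measurable_le_cst c) (measurable_funP (W i))). Qed.

Let T_L2 c i : 0 <= c -> T_ c i \in Lfun P 2%:E.
Proof.
move=> c0; apply: (@Lfun2_bounded _ _ _ _ _ c) => // w.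
by rewrite ger0_norm ?truncate_ge0// truncate_le_cst.
Qed.

Let T_L1 c i : 0 <= c -> T_ c i \in Lfun P 1.
Proof. by move=> c0; apply: Lfun_subset12 (T_L2 i c0); rewrite fin_num_measure. Qed.

Let int_id (f : R -> R) i : measurable_fun setT f -> (forall x, 0 <= f x) ->
  (\int[P]_w (f (W i w))%:E = \int[P]_w (f (W 0 w))%:E)%E.
Proof.
move=> mf f0; apply: (integral_identically_distributed (f := EFin \o f)).
- by move=> A mA; exact: Wid.
- exact/measurable_EFinP.
- by move=> x; rewrite lee_fin.
Qed.

Let ET c i : 0 <= c -> ('E_P[T_ c i] = (e_ c)%:E)%E.
Proof.
move=> c0; rewrite fineK ?expectation_fin_num ?T_L1// unlock.
by apply: int_id => [|x]; [exact: measurable_truncate|exact: truncate_ge0].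
Qed.

Let cov_T c i j : 0 <= c -> i != j -> covariance P (T_ c i) (T_ c j) = 0%E.
Proof.
move=> c0 ij.
apply: covariance_independent_ge0 (Windep ij) => [| |x|x| |].
- exact: measurable_truncate.
- exact: measurable_truncate.
- exact: truncate_ge0.
- exact: truncate_ge0.
- exact: T_L2.
- exact: T_L2.
Qed.

(** Dropping the squared mean leaves the second moment, which equality in law transfers to index
    0. *)
Let var_T c i : 0 <= c ->
  ('V_P[T_ c i] <= \int[P]_w (T_ c 0 w ^+ 2)%:E)%E.
Proof.
move=> c0; rewrite varianceE ?T_L2//.
have -> : ('E_P[T_ c i ^+ 2] = \int[P]_w (T_ c 0 w ^+ 2)%:E)%E.
  rewrite unlock; apply: (int_id (f := fun x => truncate c x ^+ 2)) => [|x].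
    by apply: measurable_funX; exact: measurable_truncate.
  exact: sqr_ge0.
by rewrite leeBlDr ?leeDl// ?sqre_ge0// ET.
Qed.

Let msum c n : measurable_fun setT (fun w => \sum_(i < n) T_ c i w).
Proof. by apply: measurable_sum => i; exact: mT. Qed.

Let average_deviation (c : R) (k : nat) (w : T) :=
  k%:R^-1 * \sum_(i < k) T_ c i w - e_ c.

(** Variances add by pairwise independence, so dividing the sum by [k] leaves a factor [k / k ^ 2]
    on a single second moment. *)
Let second_moment_average c k : 0 <= c -> (0 < k)%N ->
  (\int[P]_w (average_deviation c k w ^+ 2)%:E <=
   (k%:R^-1)%:E * \int[P]_w (T_ c 0 w ^+ 2)%:E)%E.
Proof.
move=> c0 k0.
have kR : k%:R != 0 :> R by rewrite pnatr_eq0 -lt0n.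
have Esum : ('E_P[(fun w => \sum_(i < k) T_ c i w)%R] = (k%:R * e_ c)%:E)%E.
  rewrite unlock; under eq_integral do rewrite -sumEFin.
  rewrite ge0_integral_sum//; last 2 first.
  - by move=> i; apply/measurable_EFinP; exact: mT.
  - by move=> i w _; rewrite lee_fin truncate_ge0.
  rewrite (eq_bigr (fun=> (e_ c)%:E)).
    by rewrite sumEFin sumr_const card_ord mulr_natl.
  by move=> i _; have := ET i c0; rewrite unlock.
have <- : ((k%:R ^- 2)%:E * 'V_P[(fun w => \sum_(i < k) T_ c i w)%R] =
          \int[P]_w (average_deviation c k w ^+ 2)%:E)%E.
  rewrite (_ : 'V_P[_]%E = (\int[P]_w
      ((\sum_(i < k) T_ c i w - k%:R * e_ c) ^+ 2)%:E)%E); last first.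
    by rewrite /variance covariance.unlock Esum expectation.unlock.
  rewrite -ge0_integralZl//.
  - apply: eq_integral => w _.
    rewrite /average_deviation -EFinM; congr EFin; field.
    exact: kR.
  - apply/measurable_EFinP; apply: measurable_funM; apply: measurable_funB => //.
  - by move=> w _; rewrite lee_fin sqr_ge0.
rewrite variance_sum_uncorrelated; last 2 first.
- by move=> i; exact: T_L2.
- by move=> i j; exact: cov_T.
apply: (@le_trans _ _ ((k%:R ^- 2)%:E *
    \sum_(i < k) \int[P]_w (T_ c 0 w ^+ 2)%:E)%E).
  rewrite lee_wpmul2l ?lee_fin ?invr_ge0 ?exprn_ge0//.
  by apply: lee_sum => i _; exact: var_T.
rewrite sume_const_ge0; last first.
  by apply: integral_ge0 => w _; rewrite lee_fin sqr_ge0.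
by rewrite muleA -EFinM expr2 invfM -mulrA mulVf// mulr1.
Qed.


(* The factor 2 comes from [a ^+ n <= 2 * truncn (a ^+ n)]. *)
Let second_moment_truncated_avg a n : 1 < a ->
  (\int[P]_w (average_deviation (a ^+ n) (Num.truncn (a ^+ n)) w ^+ 2)%:E <=
   \int[P]_w (2 * (W 0 w ^+ 2 *
      ((W 0 w <= 1 * a ^+ n)%R%:R / (1 * a ^+ n))))%:E)%E.
Proof.
move=> a1; have [k0 _ k2 _] := truncn_exprn_bounds n (ltW a1).
set k := Num.truncn (a ^+ n) in k0 k2 *.
have an0 : 0 < a ^+ n by rewrite exprn_gt0//; lra.
apply: le_trans (second_moment_average (ltW an0) _) _; first by rewrite -(ltr0n R).
have mTsq : measurable_fun setT (fun w => (T_ (a ^+ n) 0 w ^+ 2)%:E).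
  by apply/measurable_EFinP; apply: measurable_funX; exact: mT.
have sqE w : [set: T] w -> (0 <= (T_ (a ^+ n) 0 w ^+ 2)%:E)%E.
  by rewrite lee_fin sqr_ge0.
rewrite -(ge0_integralZl _ measurableT mTsq sqE) ?lee_fin ?invr_ge0 ?(ltW k0)//.
apply: ge0_le_integral => //.
- by move=> w _; rewrite -EFinM lee_fin mulr_ge0 ?sqr_ge0// invr_ge0 ltW.
- exact: measurable_funeM.
- apply/measurable_EFinP; apply: measurable_funM => //; apply: measurable_funM.
    exact: measurable_funX.
  exact: measurable_funM.
- move=> w _; rewrite -EFinM lee_fin mul1r /T_ truncateE//.
  have [_|_] := leP (W 0 w) (a ^+ n).
    have kA : k%:R^-1 <= 2 / a ^+ n.
      by rewrite ler_pdivlMr// mulrC ler_pdivrMr.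
    rewrite mulr1 mul1r mulrC [leRHS]mulrCA.
    by rewrite ler_wpM2l ?sqr_ge0.
  by rewrite mulr0 expr0n/= mulr0 mul0r !mulr0.
Qed.

Let measurable_average_deviation c k :
  measurable_fun setT (average_deviation c k).
Proof. by apply: measurable_funB => //; exact: measurable_funM. Qed.

Let ae_average_deviation a : 1 < a ->
  {ae P, forall w,
    average_deviation (a ^+ n) (Num.truncn (a ^+ n)) w @[n --> \oo] --> (0 : R)}.
Proof.
move=> a1; have aB : 0 < a - 1 by lra.
have : {ae P, forall w,
    average_deviation (a ^+ n) (Num.truncn (a ^+ n)) w ^+ 2 @[n --> \oo] --> (0 : R)}.
  apply: ae_cvg0_summable => [n|n w|].
  - by apply: measurable_funX; exact: measurable_average_deviation.
  - exact: sqr_ge0.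
  (* The form [1 * a ^+ n] matches [geometric_tail_le] at [c = 1]. Its bound [w^-1 * (a / (a - 1))]
     times [w ^+ 2] is linear in [w], hence the integrable majorant [g] below. *)
  pose f n w := 2 * (W 0 w ^+ 2 *
      ((W 0 w <= 1 * a ^+ n)%R%:R / (1 * a ^+ n))).
  apply: (@le_lt_trans _ _ (\sum_(0 <= n <oo) \int[P]_w (f n w)%:E)%E).
    apply: lee_nneseries => [n _ _|n _].
      by apply: integral_ge0 => w _; rewrite lee_fin sqr_ge0.
    exact: second_moment_truncated_avg.
  apply: (nneseries_integral_lty (g := fun w => 2 * (a / (a - 1)) * W 0 w)).
  - move=> n; apply: measurable_funM => //; apply: measurable_funM.
      exact: measurable_funX.
    exact: measurable_funM.
  - move=> n w; rewrite mulr_ge0// mulr_ge0 ?sqr_ge0// divr_ge0// mul1r exprn_ge0//.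
    by lra.
  - by apply: measurable_funM.
  - move=> N w; rewrite -mulr_sumr -mulrA ler_pM2l// -mulr_sumr.
    (* [geometric_tail_le] requires a positive [w]; where [W 0 w = 0] the summands vanish. *)
    have := W0 0 w; rewrite le_eqVlt => /predU1P[<-|w0].
      by rewrite expr0n mul0r mulr0.
    have := geometric_tail_le N a1 w0 (@ltr01 R).
    set S := (X in X <= _ -> _) => HS.
    rewrite expr2 -mulrA [leRHS]mulrC ler_pM2l//.
    rewrite mulrC -ler_pdivlMr//; apply: le_trans HS _.
    rewrite [leRHS]mulrC ler_wpM2r// ?divr_ge0//; try lra.
    by rewrite ge_min lexx orbT.
  - under eq_integral do rewrite EFinM.
    rewrite ge0_integralZl//; last 3 first.
    + exact/measurable_EFinP.
    + by move=> w _; rewrite lee_fin.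
    + by rewrite lee_fin mulr_ge0// divr_ge0//; lra.
    by rewrite intW -EFinM ltry.
(* Tolerance [e ^+ 2] for the squares is tolerance [e] for the deviations. *)
apply: filterS => w /cvgr0Pnorm_le sq0; apply/cvgr0Pnorm_le => e e0.
have := sq0 _ (exprn_gt0 2 e0); apply: filterS => n /=.
by rewrite normrX ler_pXn2r// nnegrE// ltW.
Qed.

(** Dominated convergence with majorant [W 0]: at each point the truncation at [a ^+ n] is
    eventually inactive. *)
Let cvg_e a : 1 < a -> e_ (a ^+ n) @[n --> \oo] --> m.
Proof.
move=> a1; have a0 n : 0 <= a ^+ n by rewrite exprn_ge0//; lra.
have iW : P.-integrable setT (EFin \o W 0).
  apply/integrableP; split; first exact/measurable_EFinP.
  under eq_integral do rewrite /= ger0_norm//.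
  by rewrite intW ltry.
have mTE n : measurable_fun setT (EFin \o T_ (a ^+ n) 0) by exact/measurable_EFinP.
have mWE : measurable_fun setT (EFin \o W 0) by exact/measurable_EFinP.
have cvgT : {ae P, forall w, [set: T] w ->
    (EFin \o T_ (a ^+ n) 0) w @[n --> \oo] --> (EFin \o W 0) w}.
  apply: aeW => w _; apply: cvg_near_cst; near=> n; rewrite /= /T_ truncateE//.
  suff -> : W 0 w <= a ^+ n by rewrite mulr1.
  by near: n; move/cvgryPge : (cvgy_exprn a1); apply.
have leT : {ae P, forall w n, [set: T] w ->
    (`|(EFin \o T_ (a ^+ n) 0) w| <= (EFin \o W 0) w)%E}.
  apply: aeW => w n _ /=.
  rewrite lee_fin ger0_norm ?truncate_ge0// /T_ truncateE//.
  by rewrite ler_piMr// lern1 leq_b1.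
have [_ _] := dominated_convergence measurableT mTE mWE cvgT iW leT.
rewrite /= intW.
have eE n : (\int[P]_w (T_ (a ^+ n) 0 w)%:E = (e_ (a ^+ n))%:E)%E.
  by rewrite -(ET 0 (a0 n)) unlock.
under eq_fun do rewrite eE.
by move/fine_cvgP => [].
Unshelve. all: by end_near. Qed.

Let f_tail (c x : R) : R := (c < x)%R%:R.

Let mf_tail c : measurable_fun setT (f_tail c).
Proof.
rewrite (_ : f_tail c = fun x => 1 - (x <= c)%R%:R).
  by apply: measurable_funB => //; exact: measurable_le_cst.
by apply/funext => x; rewrite /f_tail ltNge; case: (x <= c); rewrite ?subrr ?subr0.
Qed.

Let mf_tailW c i : measurable_fun setT (fun w => f_tail c (W i w)).
Proof. exact: (measurableT_comp (mf_tail c) (measurable_funP (W i))). Qed.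

(** The sum counts those of the first [truncn (a ^+ n)] variables above the level; its mean is at
    most [a ^+ n * P (W 0 > a ^+ n)], summable by [geometric_head_le]. *)
Let ae_tail a : 1 < a ->
  {ae P, forall w, \sum_(i < Num.truncn (a ^+ n)) f_tail (a ^+ n) (W i w)
    @[n --> \oo] --> (0 : R)}.
Proof.
move=> a1; have aB : 0 < a - 1 by lra.
have mS n : measurable_fun setT
    (fun w => \sum_(i < Num.truncn (a ^+ n)) f_tail (a ^+ n) (W i w)).
  by apply: measurable_sum => i; exact: mf_tailW.
apply: ae_cvg0_summable => [n|n w|].
- exact: mS.
- by apply: sumr_ge0 => i _; rewrite ler0n.
pose f n w := f_tail (a ^+ n) (W 0 w) * a ^+ n.
apply: (@le_lt_trans _ _ (\sum_(0 <= n <oo) \int[P]_w (f n w)%:E)%E).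
  apply: lee_nneseries => [n _ _|n _].
    by apply: integral_ge0 => w _; rewrite lee_fin sumr_ge0// => i _; rewrite ler0n.
  have [k0 kle _ _] := truncn_exprn_bounds n (ltW a1).
  under eq_integral do rewrite -sumEFin.
  rewrite ge0_integral_sum//; last 2 first.
  - by move=> i; apply/measurable_EFinP; exact: mf_tailW.
  - by move=> i w _; rewrite lee_fin ler0n.
  rewrite (eq_bigr (fun=> \int[P]_w (f_tail (a ^+ n) (W 0 w))%:E)%E); last first.
    by move=> i _; apply: int_id => // x; rewrite ler0n.
  have i0 : (0 <= \int[P]_w (f_tail (a ^+ n) (W 0 w))%:E)%E.
    by apply: integral_ge0 => w _; rewrite lee_fin ler0n.
  rewrite sume_const_ge0//.
  have f0E w : [set: T] w -> (0 <= (f_tail (a ^+ n) (W 0 w))%:E)%E.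
    by rewrite lee_fin ler0n.
  have mfE : measurable_fun setT (fun w => (f_tail (a ^+ n) (W 0 w))%:E).
    by apply/measurable_EFinP; exact: mf_tailW.
  rewrite /f; under [leRHS]eq_integral do rewrite EFinM muleC.
  rewrite ge0_integralZl// ?lee_fin ?exprn_ge0//; last lra.
  by rewrite lee_wpmul2r.
apply: (nneseries_integral_lty (g := fun w => (a / (a - 1)) * W 0 w)).
- by move=> n; apply: measurable_funM => //.
- by move=> n w; rewrite mulr_ge0 ?ler0n// exprn_ge0//; lra.
- by apply: measurable_funM.
- by move=> N w; rewrite mulrC; exact: geometric_head_le.
under eq_integral do rewrite EFinM.
have a0 : 0 <= a / (a - 1) by rewrite divr_ge0//; lra.
have f0E w : [set: T] w -> (0 <= (W 0 w)%:E)%E by rewrite lee_fin.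
have mfE : measurable_fun setT (fun w => (W 0 w)%:E) by exact/measurable_EFinP.
by rewrite ge0_integralZl// intW -EFinM ltry.
Qed.

Lemma strong_law_geometric_subseq (a : R) : 1 < a ->
  {ae P, forall w, (Num.truncn (a ^+ n))%:R^-1 *
    \sum_(i < Num.truncn (a ^+ n)) W i w @[n --> \oo] --> m}.
Proof.
move=> a1.
apply: filterS2 (ae_tail a1) (ae_average_deviation a1) => w tail0 dev0.
have avg : average_deviation (a ^+ n) (Num.truncn (a ^+ n)) w + e_ (a ^+ n)
    @[n --> \oo] --> m.
  by rewrite -[m]add0r; apply: cvgD => //; exact: cvg_e.
apply: cvg_trans avg; apply: near_eq_cvg; near=> n.
rewrite /average_deviation subrK; congr (_ * _); apply: eq_bigr => i _.
rewrite /T_ truncateE//; case: leP => [_|aW]; first by rewrite mulr1.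
(* The count tends to 0, so it is eventually below 1, whereas the index [i] alone would contribute
   1. *)
have : \sum_(i < Num.truncn (a ^+ n)) f_tail (a ^+ n) (W i w) < 1.
  near: n; move/cvgr0Pnorm_lt : tail0 => /(_ 1 ltr01).
  by apply: filterS => n; apply: le_lt_trans; exact: ler_norm.
rewrite (bigD1 i)//= {1}/f_tail aW ltNge => /negP[].
by rewrite (lerDl 1) sumr_ge0// => j _; rewrite ler0n.
Unshelve. all: by end_near. Qed.

(** Only the countably many ratios [1 + 1 / (j + 1)] are used, so one null set serves them all;
    nonnegativity makes the partial sums monotone for the interpolation. *)
Theorem strong_law_ge0 :
  {ae P, forall w, n%:R^-1 * \sum_(i < n) W i w @[n --> \oo] --> m}.
Proof.
have a1 (j : nat) : 1 < 1 + j.+1%:R^-1 :> R by rewrite ltrDl invr_gt0 ltr0n.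
have := ae_foralln (fun j => strong_law_geometric_subseq (a1 j)).
apply: filterS => w Hw.
apply: (cvg_average_geometric_subseq (S := fun n => \sum_(i < n) W i w)) => //.
- by move=> n; apply: sumr_ge0 => i _; exact: W0.
- move=> i j ij; rewrite -!(big_mkord xpredT (fun i => W i w)).
  by rewrite (big_cat_nat (leq0n i) ij) /= lerDl sumr_ge0.
Qed.

End strong_law.

(** * Pairs of coordinates *)

Section covariance_independent_real.
Context (d : measure_display) (T : measurableType d) (R : realType)
  (P : probability T R).

(** Splitting into positive and negative parts and expanding bilinearly reduces signed variables to
    the nonnegative case. *)
Lemma covariance_independent (U V : {RV P >-> R}) :
  (U : T -> R) \in Lfun P 2%:E -> (V : T -> R) \in Lfun P 2%:E ->
  independent_pair P U V -> covariance P U V = 0%E.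
Proof.
move=> U2 V2 UV.
pose p (x : R) := Num.max 0 x; pose q (x : R) := Num.max 0 (- x).
have mp : measurable_fun setT p by exact: measurable_maxr.
have mq : measurable_fun setT q.
  by apply: measurable_maxr => //; exact: measurableT_comp.
have p0 x : 0 <= p x by rewrite le_max lexx.
have q0 x : 0 <= q x by rewrite le_max lexx.
have pq x : x = p x - q x.
  by rewrite /p /q; case: (leP 0 x) => ?; [rewrite max_l ?oppr_le0// subr0|
    rewrite max_r ?oppr_ge0 ?ltW// sub0r opprK].
have L2 (f : R -> R) (Z : {RV P >-> R}) : measurable_fun setT f ->
    (forall x, f x ^+ 2 <= x ^+ 2) ->
    (Z : T -> R) \in Lfun P 2%:E -> (fun w => f (Z w)) \in Lfun P 2%:E.
  move=> mf fx Z2.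
  have mfZ : measurable_fun setT (fun w => f (Z w)) by exact: measurableT_comp.
  apply: Lfun2_sqr => //.
  have /integrableP[_] := Lfun2_integrable_sqr Z2.
  apply: le_lt_trans; apply: ge0_le_integral => //.
  - by move=> w _; rewrite lee_fin sqr_ge0.
  - by apply/measurable_EFinP; exact: measurable_funX.
  - apply: measurableT_comp => //.
    by apply/measurable_EFinP; exact: measurable_funX.
  - by move=> w _; rewrite /= lee_fin ger0_norm ?sqr_ge0.
have p2 x : p x ^+ 2 <= x ^+ 2.
  by rewrite /p; case: (leP 0 x) => // _; rewrite expr0n sqr_ge0.
have q2 x : q x ^+ 2 <= x ^+ 2.
  by rewrite /q; case: (leP 0 (- x)) => // _; rewrite ?sqrrN// expr0n sqr_ge0.
have -> : (U : T -> R) = (fun w => p (U w)) \- (fun w => q (U w)).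
  by apply/funext => w; exact: pq.
have -> : (V : T -> R) = (fun w => p (V w)) \- (fun w => q (V w)).
  by apply/funext => w; exact: pq.
have pU := L2 _ _ mp p2 U2; have qU := L2 _ _ mq q2 U2.
have pV := L2 _ _ mp p2 V2; have qV := L2 _ _ mq q2 V2.
rewrite covarianceBl//; last by rewrite rpredB// lee1n.
rewrite !covarianceBr// !covariance_independent_ge0//.
by rewrite !sube0.
Qed.

End covariance_independent_real.

Section coordinate_pairs.
Context (d : measure_display) (T : measurableType d) (R : realType)
  (P : probability T R) (X Y : nat -> {RV P >-> R}).
Hypothesis indep : mutually_independent (joint_family X Y).
Hypothesis ident : identically_distributed (joint_family X Y).

Lemma independent_coordinates i A B : measurable A -> measurable B ->
  P (X i @^-1` A `&` Y i @^-1` B) = (P (X i @^-1` A) * P (Y i @^-1` B))%E.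
Proof.
move=> mA mB.
have := @indep [:: inl i; inr i] (fun k => if k is inl _ then A else B) isT.
rewrite bigcap_seq !big_cons !big_nil/= setIT mule1; apply.
by case.
Qed.

(** Mutual independence at [inl i], [inr i], [inl j], [inr j], distinct because [i != j], turns both
    sides into the same product of four probabilities. *)
Lemma independent_rectangle_pairs i j A1 A2 B1 B2 : i != j ->
  measurable A1 -> measurable A2 -> measurable B1 -> measurable B2 ->
  P (X i @^-1` A1 `&` Y i @^-1` A2 `&` (X j @^-1` B1 `&` Y j @^-1` B2)) =
  (P (X i @^-1` A1 `&` Y i @^-1` A2) * P (X j @^-1` B1 `&` Y j @^-1` B2))%E.
Proof.
move=> ij mA1 mA2 mB1 mB2; rewrite !independent_coordinates//.
pose B k := match k with
  | inl a => if a == i then A1 else B1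
  | inr a => if a == i then A2 else B2 end.
have us : uniq [:: inl i; inr i; inl j; inr j : nat + nat].
  have ijl : (inl i == inl j :> nat + nat) = false.
    by apply/eqP => -[]; exact/eqP.
  have ijr : (inr i == inr j :> nat + nat) = false.
    by apply/eqP => -[]; exact/eqP.
  by rewrite /= !inE ijl ijr.
have := indep us (B := B).
rewrite bigcap_seq !big_cons !big_nil/= setIT mule1 eqxx eq_sym (negPf ij).
rewrite -!setIA -!muleA; apply.
by move=> [a|a] /=; case: ifP.
Qed.

Let pair i w := (X i w, Y i w).

(** Rectangles suffice for one pair at a time: first for [pair j] with the event of [pair i] held
    fixed, then for [pair i] against a rectangle of [pair j]. *)
Lemma independent_pairs i j : i != j -> independent_pair P (pair i) (pair j).
Proof.
move=> ij A B mA mB.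
rewrite setIC muleC; apply: independent_rectangles => // [|B1 B2 mB1 mB2].
  exact: measurable_pair_preimage.
rewrite setIC muleC; apply: independent_rectangles => // [|A1 A2 mA1 mA2].
  by apply: measurableI; exact: measurable_funPTI.
exact: independent_rectangle_pairs.
Qed.

(** Preimages under [g] carry pairwise independence and equality in law from the pairs to their
    images. *)
Lemma strong_law_pairs (g : R * R -> R) (m : R) :
  @measurable_fun _ _ (R * R)%type R setT g -> (forall p, 0 <= g p) ->
  (\int[P]_w (g (X 0 w, Y 0 w))%:E = m%:E)%E ->
  {ae P, forall w, n%:R^-1 * \sum_(i < n) g (X i w, Y i w) @[n --> \oo] --> m}.
Proof.
move=> mg g0 gm.
have mW i : measurable_fun setT (fun w => g (X i w, Y i w)).
  by apply: (measurableT_comp mg); exact: measurable_fun_pair.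
pose W i : {RV P >-> R} := mfun_Sub (mem_set (mW i)).
have mpre A : measurable A -> measurable (g @^-1` A).
  by move=> mA; rewrite -[X in measurable X]setTI; exact: mg.
apply: (strong_law_ge0 (W := W)) => [i w|i j ij A B mA mB|i B mB|].
- exact: g0.
- exact: (independent_pairs ij (mpre _ mA) (mpre _ mB)).
(* On rectangles the law of a pair is the product of its marginals, and these do not depend on the
   index. *)
- have H := @identically_distributed_pair _ _ _ P _ _ _ _ (X i) (X 0) (Y i) (Y 0).
  apply: (H _ (g @^-1` B) (mpre _ mB)) => A1 A2 mA1 mA2.
  rewrite !independent_coordinates//.
  have := @ident (inl i) (inl 0%N) _ mA1; have := @ident (inr i) (inr 0%N) _ mA2.
  by rewrite /distribution /pushforward /= => -> ->.
- by rewrite unlock.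
Qed.

End coordinate_pairs.

(** * The stretch move *)

(** The variance centres at the real number [c], which [fine] defines even before the expectation is
    known to be finite; so [f - c], and then [f], is square integrable. *)
Lemma Lfun2_variance_lty (d : measure_display) (T : measurableType d)
    (R : realType) (P : probability T R) (f : {RV P >-> R}) :
  ('V_P[f] < +oo)%E -> (f : T -> R) \in Lfun P 2%:E.
Proof.
rewrite /variance covariance.unlock expectation.unlock => foo.
pose c := fine (\int[P]_w (f w)%:E)%E.
have fc2 : (fun w => f w - c) \in Lfun P 2%:E.
  by apply: Lfun2_sqr => //; exact: measurable_funB.
have -> : (f : T -> R) = (fun w => f w - c) \+ cst c.
  by apply/funext => w; rewrite /= subrK.
have cst2 : cst c \in Lfun P 2%:E by rewrite Lfun_cst.
by rewrite rpredD// lee1n.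
Qed.

Lemma integral_sqr_variance (d : measure_display) (T : measurableType d)
    (R : realType) (P : probability T R) (f : T -> R) (mu v : R) :
  f \in Lfun P 2%:E -> 'E_P[f]%E = mu%:E -> 'V_P[f]%E = v%:E ->
  (\int[P]_w (f w ^+ 2)%:E = (v + mu ^+ 2)%:E)%E.
Proof.
move=> f2 Ef; rewrite varianceE// Ef expectation.unlock => Vf.
by rewrite EFinD -Vf -EFin_expe subeK.
Qed.

Section stretch_limit.
Context (R : realType).

Lemma log_ratio_rate (n : nat) (x y : nat -> R) (z : R) : (0 < n)%N ->
  n%:R^-1 * log_ratio (\row_(i < n) x i) (\row_(i < n) y i) z =
  (1 - n%:R^-1) * ln z
  - 2^-1 * (n%:R^-1 * \sum_(i < n) (z * x i + (1 - z) * y i) ^+ 2)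
  + 2^-1 * (n%:R^-1 * \sum_(i < n) x i ^+ 2).
Proof.
move=> n0; have nR : n%:R != 0 :> R by rewrite pnatr_eq0 -lt0n.
rewrite /log_ratio.
under eq_bigr do rewrite !mxE.
under [X in _ + 2^-1 * X]eq_bigr do rewrite mxE.
by field.
Qed.

(** Once [h / n] is positive the minimum equals 1, so the sequence is eventually constant. *)
Lemma acceptance_prob_cvg1 (x y : forall n, 'rV[R]_n) (z f : R) : 0 < f ->
  n%:R^-1 * log_ratio (x n) (y n) z @[n --> \oo] --> f ->
  acceptance_prob (x n) (y n) z @[n --> \oo] --> (1 : R).
Proof.
move=> f0 hf; apply: cvg_near_cst; near=> n.
rewrite /acceptance_prob min_l// -expR0 ler_expR.
have n0 : 0 < n%:R^-1 :> R by rewrite invr_gt0 ltr0n; near: n; exact: nbhs_infty_gt.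
rewrite -(pmulr_rge0 _ n0) ltW//.
by near: n; exact: cvgr_gt hf 0 f0.
Unshelve. all: by end_near. Qed.

(** Eventually [h < n f / 2], because [f < f / 2] for negative [f], and [exp (n f / 2)] tends to
    0. *)
Lemma acceptance_prob_cvg0 (x y : forall n, 'rV[R]_n) (z f : R) : f < 0 ->
  n%:R^-1 * log_ratio (x n) (y n) z @[n --> \oo] --> f ->
  acceptance_prob (x n) (y n) z @[n --> \oo] --> (0 : R).
Proof.
move=> f0 hf; apply/cvgr0Pnorm_le => e e0.
have f2 : f < f / 2 by lra.
near=> n.
have n0 : 0 < n%:R :> R by rewrite ltr0n; near: n; exact: nbhs_infty_gt.
rewrite /acceptance_prob ger0_norm; last by rewrite le_min ler01 expR_ge0.
rewrite ge_min; apply/orP; right.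
rewrite -[leRHS]lnK ?posrE// ler_expR.
have hn : n%:R^-1 * log_ratio (x n) (y n) z < f / 2.
  by near: n; exact: cvgr_lt hf (f / 2) f2.
rewrite mulrC ltr_pdivrMr// in hn.
apply: le_trans (ltW hn) _.
(* This is [n f / 2 <= ln e], solved for [n] with the positive divisor [- f]. *)
have : - (2 * ln e / - f) <= n%:R.
  near: n; exact: nbhs_infty_ger.
by rewrite -mulNr ler_pdivrMr; lra.
Unshelve. all: by end_near. Qed.

End stretch_limit.

(** The vectors of all dimensions are initial segments of the same two sequences, which gives almost
    sure convergence in [n] a meaning. *)
Theorem proposition5 (d : measure_display) (T : measurableType d)
    (R : realType) (P : probability T R)
    (X Y : nat -> {RV P >-> R}) (mu sigma z : R)
    (hindep : mutually_independent (joint_family X Y))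
    (hident : identically_distributed (joint_family X Y))
    (hmean : forall k, ('E_P[joint_family X Y k] = mu%:E)%E)
    (hvar : forall k, ('V_P[joint_family X Y k] = (sigma ^+ 2)%R%:E)%E)
    (hz : 0 < z) :
  [/\ {ae P, forall w,
        n%:R^-1 * log_ratio (random_vector X n w) (random_vector Y n w) z
          @[n --> \oo] --> limit_rate sigma z},
      0 < limit_rate sigma z ->
        {ae P, forall w,
          acceptance_prob (random_vector X n w) (random_vector Y n w) z
            @[n --> \oo] --> (1 : R)}
    & limit_rate sigma z < 0 ->
        {ae P, forall w,
          acceptance_prob (random_vector X n w) (random_vector Y n w) z
            @[n --> \oo] --> (0 : R)}].
Proof.
have X2 k : (joint_family X Y k : T -> R) \in Lfun P 2%:E.
  by apply: Lfun2_variance_lty; rewrite hvar ltry.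
have X02 := X2 (inl 0%N); have Y02 := X2 (inr 0%N); rewrite /= in X02 Y02.
have Pfin : P setT \is a fin_num by rewrite fin_num_measure.
have X01 := Lfun_subset12 Pfin X02; have Y01 := Lfun_subset12 Pfin Y02.
have EX := hmean (inl 0%N); have EY := hmean (inr 0%N).
have VX := hvar (inl 0%N); have VY := hvar (inr 0%N).
rewrite /= in EX EY VX VY.
have covXY : covariance P (X 0%N) (Y 0%N) = 0%E.
  apply: covariance_independent => // A B mA mB.
  exact: (independent_coordinates hindep).
(* [U] is the first coordinate of the proposed point. Its weights sum to 1, which keeps the mean
   [mu], and the zero covariance removes the cross term from its variance. *)
pose U := (z \o* (X 0%N : T -> R)) \+ ((1 - z) \o* (Y 0%N : T -> R)).
have zX2 : z \o* (X 0%N : T -> R) \in Lfun P 2%:E by rewrite Lfun_scale// ler1n.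
have zY2 : (1 - z) \o* (Y 0%N : T -> R) \in Lfun P 2%:E.
  by rewrite Lfun_scale// ler1n.
have U2 : U \in Lfun P 2%:E by rewrite rpredD// lee1n.
have EU : ('E_P[U] = mu%:E)%E.
  rewrite expectationD ?Lfun_scale// !expectationZl// EX EY -!EFinM -EFinD.
  by congr EFin; ring.
have VU : ('V_P[U] = ((z ^+ 2 + (1 - z) ^+ 2) * sigma ^+ 2)%:E)%E.
  rewrite varianceD// !varianceZ// VX VY covarianceZl//; last 2 first.
  - by rewrite Lfun_scale.
  - exact: Lfun2_mul_Lfun1.
  rewrite covarianceZr//; last exact: Lfun2_mul_Lfun1.
  rewrite covXY !mule0 adde0 -!EFinM -EFinD.
  by congr EFin; ring.
have slln1 := @strong_law_pairs _ _ _ _ _ _ hindep hident (fun p => p.1 ^+ 2)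
  (sigma ^+ 2 + mu ^+ 2).
have slln2 := @strong_law_pairs _ _ _ _ _ _ hindep hident
  (fun p => (z * p.1 + (1 - z) * p.2) ^+ 2)
  ((z ^+ 2 + (1 - z) ^+ 2) * sigma ^+ 2 + mu ^+ 2).
have {}slln1 : {ae P, forall w,
    n%:R^-1 * (\sum_(i < n) X i w ^+ 2) @[n --> \oo] --> sigma ^+ 2 + mu ^+ 2}.
  apply: slln1.
  - by apply: measurable_funX; exact: measurable_fst.
  - by move=> p; exact: sqr_ge0.
  - exact: integral_sqr_variance.
have {}slln2 : {ae P, forall w,
    n%:R^-1 * (\sum_(i < n) (z * X i w + (1 - z) * Y i w) ^+ 2)
    @[n --> \oo] --> (z ^+ 2 + (1 - z) ^+ 2) * sigma ^+ 2 + mu ^+ 2}.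
  apply: slln2.
  - apply: measurable_funX; apply: measurable_funD; apply: measurable_funM => //.
  - by move=> p; exact: sqr_ge0.
  - rewrite -(integral_sqr_variance U2 EU VU); apply: eq_integral => w _.
    by rewrite /U /= (mulrC z) (mulrC (1 - z)).
have rate : {ae P, forall w,
    n%:R^-1 * log_ratio (random_vector X n w) (random_vector Y n w) z
      @[n --> \oo] --> limit_rate sigma z}.
  apply: filterS2 slln1 slln2 => w h1 h2.
  (* The [mu ^+ 2] terms cancel and [1 - z ^ 2 - (1 - z) ^ 2 = - 2 z (z - 1)]; the unsimplified
     [1 - 0] is the limit of [1 - 1 / n]. *)
  have -> : limit_rate sigma z = (1 - 0) * ln z -
      2^-1 * ((z ^+ 2 + (1 - z) ^+ 2) * sigma ^+ 2 + mu ^+ 2) +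
      2^-1 * (sigma ^+ 2 + mu ^+ 2).
    by rewrite /limit_rate; field.
  have inv0 : (n%:R^-1 : R) @[n --> \oo] --> (0 : R).
    apply/gtr0_cvgV0; last exact: cvgr_idn.
    by near=> n; rewrite ltr0n; near: n; exact: nbhs_infty_gt.
  have c0 : (1 - n%:R^-1) * ln z @[n --> \oo] --> (1 - 0) * ln z.
    by apply: cvgM; [apply: cvgB; [exact: cvg_cst|exact: inv0]|exact: cvg_cst].
  have c1 : 2^-1 * (n%:R^-1 * \sum_(i < n) X i w ^+ 2) @[n --> \oo] -->
      2^-1 * (sigma ^+ 2 + mu ^+ 2).
    by apply: cvgM; [exact: cvg_cst|exact: h1].
  have c2 : 2^-1 * (n%:R^-1 * \sum_(i < n) (z * X i w + (1 - z) * Y i w) ^+ 2)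
      @[n --> \oo] --> 2^-1 * ((z ^+ 2 + (1 - z) ^+ 2) * sigma ^+ 2 + mu ^+ 2).
    by apply: cvgM; [exact: cvg_cst|exact: h2].
  (* The decomposition divides by [n], so it is claimed only for large [n]. *)
  suff rateE : \forall n \near \oo,
      (1 - n%:R^-1) * ln z
      - 2^-1 * (n%:R^-1 * \sum_(i < n) (z * X i w + (1 - z) * Y i w) ^+ 2)
      + 2^-1 * (n%:R^-1 * \sum_(i < n) X i w ^+ 2) =
      n%:R^-1 * log_ratio (random_vector X n w) (random_vector Y n w) z.
    apply: cvg_trans (near_eq_cvg rateE) _.
    by apply: cvgD; [apply: cvgB; [exact: c0|exact: c2]|exact: c1].
  near=> n.
  rewrite -(log_ratio_rate (fun i => X i w) (fun i => Y i w))//.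
  by near: n; exact: nbhs_infty_gt.
(* Both acceptance limits follow pathwise on the event where the rate converges. *)
split => // f0; apply: filterS rate => w.
- exact: acceptance_prob_cvg1.
- exact: acceptance_prob_cvg0.
Unshelve. all: by end_near. Qed.
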